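(* Let $(\Omega,\mathcal{F},\mathbb{P})$ be a probability space. Let $U:\Omega\times(0,\infty)\to\mathbb{R}$ be such that $U(\cdot,x)\in\mathbb{L}^0$ for all $x\in(0,\infty)$ and, for all $\omega\in\Omega$, the function $U(\omega,\cdot):(0,\infty)\to\mathbb{R}$ is strictly increasing, concave and continuously differentiable, with derivative (in the second variable) $U'(\omega,\cdot)$. Set $U(\cdot,0):=\lim_{x\downarrow 0}U(\cdot,x)\in[-\infty,\infty)$, $U'(\cdot,0):=\lim_{x\downarrow 0}U'(\cdot,x)\in(0,\infty]$ and $U(\cdot,\infty):=\lim_{x\to\infty}U(\cdot,x)$. Assume that $\mathbb{P}[U'(\cdot,0)=\infty]=1$ and $\mathbb{E}_{\mathbb{P}}[0\vee U(\cdot,\infty)]<\infty$. Define $\mathbb{U}:\mathbb{L}^0_+\to[-\infty,\infty)$ by $\mathbb{U}(f)=\mathbb{E}_{\mathbb{P}}[U(f)]$, where $(U(f))(\omega)=U(\omega,f(\omega))$. Let $\mathcal{C}\subset\mathbb{L}^0_+$ be convex, max-closed and bounded with $\mathcal{C}\cap\mathbb{L}^0_{++}\neq\emptyset$. Let $g\in\mathcal{C}^{\mathsf{max}}$ satisfy $\mathbb{U}(g)=\sup_{f\in\mathcal{C}}\mathbb{U}(f)<\infty$, and assume that $\mathbb{U}(ag)>-\infty$ for all $a\in(0,1)$. Then $g$ is a numéraire of $\mathcal{C}$.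
   Context: $\mathbb{L}^0$ is the set of all ($\mathbb{P}$-a.s. equivalence classes of) real-valued random variables on $(\Omega,\mathcal{F},\mathbb{P})$, with the topology induced by the metric $(f,g)\mapsto \mathbb{E}_{\mathbb{P}}[1\wedge|f-g|]$, i.e. convergence in probability. All relations between random variables are understood $\mathbb{P}$-a.s. $\mathbb{L}^0_+=\{f\in\mathbb{L}^0 : f\ge 0\}$ and $\mathbb{L}^0_{++}=\{f\in\mathbb{L}^0_+ : f>0\}$. $\vee$ denotes maximum. For $\mathcal{C}\subseteq\mathbb{L}^0_+$, $\overline{\mathcal{C}}$ is its closure; $\mathcal{C}$ is bounded if $\lim_{\ell\to\infty}\sup_{f\in\mathcal{C}}\mathbb{P}[f>\ell]=0$. An element $f\in\mathcal{C}$ is maximal in $\mathcal{C}$ if $f\le g$ and $g\in\mathcal{C}$ imply $f=g$; $\mathcal{C}^{\mathsf{max}}$ is the set of all maximal elements of $\mathcal{C}$. $\mathcal{C}$ is max-closed if every maximal element of $\overline{\mathcal{C}}$ belongs to $\mathcal{C}$. For $\mathcal{C}$ with $\mathcal{C}\cap\mathbb{L}^0_{++}\ne\emptyset$, an element $g\in\mathcal{C}$ is a numéraire of $\mathcal{C}$ if $g\in\mathbb{L}^0_{++}$ and there exists a probability measure $\mathbb{Q}$ equivalent to $\mathbb{P}$ such that $\mathbb{E}_{\mathbb{Q}}[f/g]\le 1$ for all $f\in\mathcal{C}$. *)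

(* Defs.v *)
From HB Require Import structures.
From mathcomp Require Import all_boot all_order all_algebra.
From mathcomp Require Import interval_inference.
From mathcomp Require Import all_classical all_reals all_analysis.
From mathcomp Require Import generic_quotient measurable_realfun lra.

Set Implicit Arguments.
Unset Strict Implicit.
Unset Printing Implicit Defensive.
Import Order.TTheory GRing.Theory Num.Theory.
Import numFieldNormedType.Exports.

Local Open Scope classical_set_scope.
Local Open Scope ring_scope.
Local Open Scope quotient_scope.
Local Open Scope convex_scope.

(* Elements of [L0 P] are P-a.s. equivalence classes; an element applied to a
   point of the sample space denotes the value there of a chosen measurable
   representative, so such values are only meaningful P-almost surely. *)
Definition L0 d (T : measurableType d) (R : realType) (P : probability T R) :=
  {mfun_ P, T >-> R}.
Identity Coercion aeEqMfun_of_L0 : L0 >-> aeEqMfun.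

Section L0_structure.
Context d (T : measurableType d) (R : realType) (P : probability T R).

HB.instance Definition _ := Choice.copy (L0 P) {mfun_ P, T >-> R}.

Definition L0_pi (f : T -> R) (mf : measurable_fun [set: T] f) : L0 P :=
  \pi_({mfun_ P, T >-> R}) (mfun_Sub (mem_set mf)).

Lemma L0_piE (f : T -> R) (mf : measurable_fun [set: T] f) :
  {ae P, forall w, L0_pi mf w = f w}.
Proof.
have : repr (L0_pi mf) == mfun_Sub (mem_set mf) %[mod {mfun_ P, T >-> R}].
  by rewrite reprK.
by rewrite eqmodE => /asboolP; apply: filterS => w /(_ I).
Qed.

Lemma L0_eqP (f g : L0 P) : f = g <-> {ae P, forall w, f w = g w}.
Proof.
split=> [->|fg]; first exact: nearW.
rewrite -[f]reprK -[g]reprK; apply/eqP; rewrite eqmodE; apply/asboolP.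
by apply: filterS fg.
Qed.

Lemma L0_measurable (f : L0 P) : measurable_fun [set: T] (f : T -> R).
Proof. exact: measurable_funPT. Qed.

Definition L0_zero : L0 P := L0_pi (@measurable_cst _ _ T R setT 0).
Definition L0_opp (f : L0 P) : L0 P :=
  L0_pi (measurable_funN (L0_measurable f)).
Definition L0_add (f g : L0 P) : L0 P :=
  L0_pi (measurable_funD (L0_measurable f) (L0_measurable g)).
Definition L0_scale (a : R) (f : L0 P) : L0 P :=
  L0_pi (measurable_funM (@measurable_cst _ _ T R setT a) (L0_measurable f)).

Let zeroE : {ae P, forall w, L0_zero w = 0}.
Proof. exact: L0_piE. Qed.
Let oppE f : {ae P, forall w, L0_opp f w = - f w}.
Proof. exact: L0_piE. Qed.
Let addE f g : {ae P, forall w, L0_add f g w = f w + g w}.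
Proof. exact: L0_piE. Qed.
Let scaleE a f : {ae P, forall w, L0_scale a f w = a * f w}.
Proof. exact: L0_piE. Qed.

Let addA : associative L0_add.
Proof.
move=> f g h; apply/L0_eqP.
by apply: filterS (filterI (addE f (L0_add g h))
  (filterI (addE g h)
  (filterI (addE (L0_add f g) h)
  (addE f g)))) => w [-> [-> [-> ->]]]; rewrite addrA.
Qed.
Let addC : commutative L0_add.
Proof.
move=> f g; apply/L0_eqP.
by apply: filterS (filterI (addE f g)
  (addE g f)) => w [-> ->]; rewrite addrC.
Qed.
Let add0 : left_id L0_zero L0_add.
Proof.
move=> f; apply/L0_eqP.
by apply: filterS (filterI (addE L0_zero f)
  (zeroE)) => w [-> ->]; rewrite add0r.
Qed.
Let addN : left_inverse L0_zero L0_opp L0_add.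
Proof.
move=> f; apply/L0_eqP.
by apply: filterS (filterI (addE (L0_opp f) f)
  (filterI (oppE f)
  (zeroE))) => w [-> [-> ->]];
  rewrite addNr.
Qed.

HB.instance Definition _ := GRing.isZmodule.Build (L0 P) addA addC add0 addN.

Let scaleA a b f : L0_scale a (L0_scale b f) = L0_scale (a * b) f.
Proof.
apply/L0_eqP.
by apply: filterS (filterI (scaleE a (L0_scale b f))
  (filterI (scaleE b f)
  (scaleE (a * b) f))) => w [-> [-> ->]]; rewrite mulrA.
Qed.
Let scale1 : left_id 1 L0_scale.
Proof.
by move=> f; apply/L0_eqP; apply: filterS (scaleE 1 f) => w ->; rewrite mul1r.
Qed.
Let scaleDr : right_distributive L0_scale +%R.
Proof.
move=> a f g; apply/L0_eqP.
by apply: filterS (filterI (scaleE a (L0_add f g))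
  (filterI (addE f g)
  (filterI (scaleE a f)
  (filterI (scaleE a g)
  (addE (L0_scale a f) (L0_scale a g)))))) => w [-> [-> [af [ag ->]]]];
  rewrite af ag mulrDr.
Qed.
Let scaleDl f : {morph L0_scale^~ f : a b / a + b}.
Proof.
move=> a b; apply/L0_eqP.
by apply: filterS (filterI (scaleE (a + b) f)
  (filterI (scaleE a f)
  (filterI (scaleE b f)
  (addE (L0_scale a f) (L0_scale b f))))) => w [-> [af [bf ->]]];
  rewrite af bf mulrDl.
Qed.

HB.instance Definition _ :=
  GRing.Zmodule_isLmodule.Build R (L0 P) scaleA scale1 scaleDr scaleDl.

Lemma L0_oppE (f : L0 P) : {ae P, forall w, (- f : L0 P) w = - f w}.
Proof. exact: oppE. Qed.
Lemma L0_addE (f g : L0 P) : {ae P, forall w, (f + g : L0 P) w = f w + g w}.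
Proof. exact: addE. Qed.
Lemma L0_scaleE a (f : L0 P) : {ae P, forall w, (a *: f : L0 P) w = a * f w}.
Proof. exact: scaleE. Qed.

Definition L0_edist (f g : L0 P) : \bar R :=
  \int[P]_w (Num.min 1 `|f w - g w|)%:E.
Definition L0_dist (f g : L0 P) : R := fine (L0_edist f g).

Let measurable_min1 (f g : L0 P) :
  measurable_fun [set: T] (fun w => (Num.min 1 `|f w - g w|)%:E).
Proof.
apply/measurable_EFinP; apply: measurable_minr => //.
apply: measurableT_comp => //.
by apply: measurable_funB; exact: L0_measurable.
Qed.

Let min1_ge0 (x y : R) : 0 <= Num.min 1 `|x - y|.
Proof. by rewrite le_min ler01 normr_ge0. Qed.

Lemma L0_edist_fin_num f g : L0_edist f g \is a fin_num.
Proof.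
rewrite ge0_fin_numE; last by apply: integral_ge0 => w _; rewrite lee_fin.
have := finite_measure_integrable_cst P (1 : R).
move=> /(_ setT measurableT) /integrableP[_]; apply: le_lt_trans.
apply: ge0_le_integral => //.
- apply: measurableT_comp => //.
  by apply/measurable_EFinP; exact: measurable_cst.
- by move=> w _; rewrite abse_EFin normr1 lee_fin ge_min lexx.
Qed.

Let dist_xx f : L0_dist f f = 0.
Proof.
rewrite /L0_dist /L0_edist; under eq_integral do rewrite subrr normr0 min_r//.
by rewrite integral0.
Qed.

Let dist_positivity f g : L0_dist f g = 0 -> f = g.
Proof.
move=> d0.
have : L0_edist f g = 0%E.
  by rewrite -(fineK (L0_edist_fin_num f g)) -/(L0_dist f g) d0.
have e : L0_edist f g = (\int[P]_w `|(Num.min 1 `|f w - g w|)%:E|)%E.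
  by apply: eq_integral => w _; rewrite gee0_abs// lee_fin.
rewrite e => /(ae_eq_integral_abs _ measurableT (measurable_min1 f g)) h.
apply/L0_eqP; apply: filterS h => w /(_ I) [] /eqP.
rewrite minEle; case: ifPn => _; first by rewrite oner_eq0.
by rewrite normr_eq0 subr_eq0 => /eqP.
Qed.

Let dist_sym f g : L0_dist f g = L0_dist g f.
Proof. by congr fine; apply: eq_integral => w _; rewrite distrC. Qed.

Let dist_triangle g f h : L0_dist f h <= L0_dist f g + L0_dist g h.
Proof.
have fin := L0_edist_fin_num.
rewrite -lee_fin EFinD /L0_dist !fineK//.
rewrite /L0_edist -ge0_integralD//; try by move=> w _; rewrite lee_fin.
apply: ge0_le_integral => //.
- exact: emeasurable_funD.
move=> w _; rewrite -EFinD lee_fin.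
have := ler_distD (g w) (f w) (h w).
have := normr_ge0 (f w - g w); have := normr_ge0 (g w - h w).
move: `|f w - g w| `|g w - h w| `|f w - h w| => a b c.
by rewrite !minEle; case: ifPn; case: ifPn; case: ifPn; rewrite -?ltNge; lra.
Qed.

(* the metric E_P[1 /\ |f - g|], i.e. the topology of convergence in
   probability *)
HB.instance Definition _ := isMetric.Build R (L0 P)
  dist_xx dist_positivity dist_sym dist_triangle.

End L0_structure.

Section L0_order.
Context d (T : measurableType d) (R : realType) (P : probability T R).
Implicit Types (f g : L0 P) (C : set (L0 P)).

Definition L0_le f g := {ae P, forall w, f w <= g w}.
Definition L0_nneg : set (L0 P) := [set f | {ae P, forall w, 0 <= f w}].
Definition L0_pos : set (L0 P) := [set f | {ae P, forall w, 0 < f w}].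

Definition L0_bounded C :=
  ereal_sup [set P [set w | l < f w] | f in C] @[l --> +oo%R] --> 0%E.

Definition maximal C : set (L0 P) :=
  [set f | C f /\ forall g, C g -> L0_le f g -> f = g].

Definition max_closed C := maximal (closure C) `<=` C.

Definition numeraire C g :=
  [/\ C g, L0_pos g & exists Q : probability T R,
    [/\ P `<< Q, Q `<< P &
      forall f, C f -> (\int[Q]_w (f w / g w)%:E <= 1)%E]].

End L0_order.
Arguments L0_nneg {d T R} P _.
Arguments L0_pos {d T R} P _.

Definition concave_function (R : realType) (D : set R) (f : R -> R) :=
  forall t : {i01 R},
    {in D &, forall x y : R^o, (f x : R^o) <| t |> f y <= f (x <| t |> y)}.

Section utility.
Context d (T : measurableType d) (R : realType) (P : probability T R).
(* [U w x] is a utility random field; its values at [x <= 0] play no role. *)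
Variable U : T -> R -> R.

Definition utility_at0 w : \bar R := lim ((U w x)%:E @[x --> 0^'+]).
Definition utility_aty w : \bar R := lim ((U w x)%:E @[x --> +oo%R]).
Definition marginal_utility_at0 w : \bar R :=
  lim ((derive1 (U w) x)%:E @[x --> 0^'+]).

Record utility_field : Prop := {
  utility_measurable : forall x : R, 0 < x -> measurable_fun [set: T] (U ^~ x) ;
  utility_increasing : forall w,
    {in `]0, +oo[%R &, {homo U w : x y / x < y}} ;
  utility_concave : forall w, concave_function `]0, +oo[%classic (U w) ;
  utility_derivable : forall w (x : R), 0 < x -> derivable (U w) x 1 ;
  utility_C1 : forall w, {in `]0, +oo[, continuous (derive1 (U w))}
}.

(* [U] extended to [x = 0] by its limit; negative values of [x] only arise on a
   null set when [utility_ext U w] is evaluated at some [f w] with [f] in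
   [L0_nneg P]. *)
Definition utility_ext w (x : R) : \bar R :=
  if 0 < x then (U w x)%:E else utility_at0 w.

Definition expected_utility (f : L0 P) : \bar R :=
  \int[P]_w utility_ext w (f w).

End utility.

(* Main.v *)
(* Perturbing the optimizer g towards f in C, f_e := (1 - e) g + e f, optimality
   gives E[(U(f_e) - U(g)) / e] <= 0, and tangent lines of the concave U bound
   this quotient below by - 4 (U(g/2) - U(g/4)), uniformly in e <= 1/2; this is
   where the finiteness of the expected utility of a g is used.  By Fatou's
   lemma the lower limit as e -> 0 has nonpositive expectation.  On {g = 0 < f}
   the quotient is at least U'(e f) f -> +oo, so taking f > 0 yields g > 0; then
   the limit is U'(g) (f - g), whence E[U'(g) f] <= E[U'(g) g] < +oo, and the
   probability Q with density proportional to U'(g) g makes g a numeraire. *)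

Require Import Defs.
From HB Require Import structures.
From mathcomp Require Import all_boot all_order all_algebra.
From mathcomp Require Import all_classical all_reals all_analysis.
From mathcomp Require Import interval_inference measurable_realfun lra ring.
Import Order.TTheory GRing.Theory Num.Theory.
Import numFieldNormedType.Exports.

Set Implicit Arguments.
Unset Strict Implicit.
Unset Printing Implicit Defensive.

Local Open Scope classical_set_scope.
Local Open Scope ring_scope.

(** * Tangent lines of concave functions on the positive half-line *)

Section concave_derive.
Context (R : realType) (u : R -> R).
Hypothesis u_concave : concave_function `]0, +oo[%classic u.
Hypothesis u_derivable : forall x : R, 0 < x -> derivable u x 1.

(** For [0 < t <= 1], concavity bounds the quotient [(u (x + t (y - x)) - u x) / t] below by
    [u y - u x]; then [t] tends to [0]. *)
Lemma concave_le_tangent (x y : R) : 0 < x -> 0 < y ->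
  u y <= u x + derive1 u x * (y - x).
Proof.
move=> x0 y0.
have [->|yx] := eqVneq y x; first by rewrite subrr mulr0 addr0.
have yx0 : y - x != 0 by rewrite subr_eq0.
(* Differentiating along [y - x] handles [x < y] and [y < x] together, with [t > 0] in both
   cases. *)
have ux : is_derive x (y - x) u (derive1 u x * (y - x)).
  have h : is_derive x 1 u (derive1 u x).
    by rewrite derive1E; apply: DeriveDef => //; exact: u_derivable.
  have d1 : differentiable u x by apply/derivable1_diffP; exact: u_derivable.
  apply: DeriveDef; first exact: diff_derivable.
  rewrite deriveE// derive1E' //.
  by rewrite -[in LHS](mulr1 (y - x)) linearZ /= mulrC.
have [dv <-] := ux.
rewrite -lerBlDl.
apply: (cvgr_to_ge (cvg_dnbhs_at_right dv)).
near=> t.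
have t0 : 0 < t by near: t; exact: nbhs_right_gt.
have t1 : t <= 1 by near: t; exact: nbhs_right_ltW.
have := @u_concave (Itv01 (ltW t0) t1) y x.
rewrite !inE/= !in_itv/= !andbT => /(_ y0 x0).
rewrite !convRE/= /shift/= => h.
have {}h : t * u y + (1 - t) * u x <= u (t * y + (1 - t) * x) by exact: h.
rewrite -[t^-1 *: _]/(t^-1 * _) mulrC ler_pdivlMr//.
have -> : t *: (y - x) + x = t * y + (1 - t) * x.
  by rewrite -[t *: _]/(t * _); ring.
have -> : (u y - u x) * t = t * u y + (1 - t) * u x - u x by ring.
by rewrite lerD2r.
Unshelve. all: by end_near. Qed.

(** The tangent inequalities at [x] and at [y] are added. *)
Lemma concave_derive_antitone (x y : R) : 0 < x -> x <= y ->
  derive1 u y <= derive1 u x.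
Proof.
move=> x0; rewrite le_eqVlt => /predU1P[->//|xy].
have y0 := lt_trans x0 xy.
have h1 := concave_le_tangent x0 y0; have h2 := concave_le_tangent y0 x0.
rewrite -(@ler_pM2r _ (y - x)) ?subr_gt0//; lra.
Qed.

(** The tangent at [x] is evaluated at [x + 1], where [u] is strictly larger. *)
Lemma increasing_concave_derive_gt0 (x : R) :
  {in `]0, +oo[%R &, {homo u : x y / x < y}} ->
  0 < x -> 0 < derive1 u x.
Proof.
move=> u_inc x0; have y0 : 0 < x + 1 by rewrite addr_gt0.
have := concave_le_tangent x0 y0; rewrite addrAC subrr add0r mulr1.
have : u x < u (x + 1).
  by apply: u_inc; rewrite ?in_itv/= ?andbT// ltrDl ltr01.
lra.
Qed.

End concave_derive.

(** * Measurability of a monotone random field at a random point *)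

Lemma cvg_invS_at_right0 (R : realType) :
  n.+1%:R^-1 @[n --> \oo] --> (0 : R)^'+.
Proof.
move=> A [e/= e0 eA]; have := @cvg_harmonic R => /cvgrPdist_lt/(_ _ e0).
apply: filterS => n /= ne; apply: eA => //=.
Qed.

(* [{w | F w (h w) > c}] is the union over rational [q] of
   [{w | q < h w /\ F w q > c}]. *)
Lemma measurable_monotone_field d (T : measurableType d) (R : realType)
    (F : T -> R -> R) (h : T -> R) :
  (forall x, 0 < x -> measurable_fun [set: T] (F ^~ x)) ->
  (forall w, {in `]0, +oo[, continuous (F w)}) ->
  (forall w x y, 0 < x -> x <= y -> F w x <= F w y) ->
  measurable_fun [set: T] h -> (forall w, 0 < h w) ->
  measurable_fun [set: T] (fun w => F w (h w)).
Proof.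
move=> mF cF ndF mh h0.
move=> _; apply: (measurability _ (RGenOInfty.measurableE R)) => //.
move=> _ [_ [c ->] <-]; rewrite setTI.
have -> : (fun w => F w (h w)) @^-1` `]c, +oo[ = \bigcup_(q : rat)
    if 0 < ratr q :> R then
      h @^-1` `]ratr q, +oo[ `&` (F ^~ (ratr q)) @^-1` `]c, +oo[ else set0.
  apply/seteqP; split=> [w|w [q _]].
  - rewrite /= in_itv/= andbT => cFw.
    (* Left continuity at [h w] leaves room for a positive rational [q < h w] with [c < F w q];
       monotonicity gives the other inclusion. *)
    have Fw : F w x @[x --> h w] --> F w (h w).
      by apply: cF; rewrite in_itv/= andbT.
    have : \forall x \near (h w)^'-, 0 < x /\ c < F w x.
      near=> x; split; first by near: x; exact: nbhs_left_gt.
      by near: x; exact: (cvgr_gt _ (cvg_at_left_filter Fw)).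
    move=> [e/= e0 he].
    have /rat_in_itvoo[q] : h w - e < h w by rewrite ltrBlDr ltrDl.
    rewrite in_itv/= => /andP[q1 q2].
    have [|//|q0 cq] := he (ratr q).
      by rewrite /= ger0_norm; lra.
    by exists q => //; rewrite q0; split; rewrite /= in_itv/= andbT.
  - case: ifPn => // q0 [/=]; rewrite !in_itv/= !andbT => qh cq.
    by rewrite (lt_le_trans cq)// ndF// ltW.
apply: bigcupT_measurable_rat => q; case: ifPn => // q0.
apply: measurableI; first by rewrite -[X in measurable X]setTI; exact: mh.
by rewrite -[X in measurable X]setTI; exact: (mF _ q0).
Unshelve. all: by end_near. Qed.

(** * Boundary values, tangent bounds and measurability of a utility field *)

Section utility_field_theory.
Context d (T : measurableType d) (R : realType) (U : T -> R -> R).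
Hypothesis hU : utility_field U.

Lemma utility_nondecreasing w (x y : R) : 0 < x -> x <= y -> U w x <= U w y.
Proof.
move=> x0; rewrite le_eqVlt => /predU1P[->//|xy].
by apply/ltW/(utility_increasing hU); rewrite ?in_itv/= ?andbT// (lt_trans x0).
Qed.

Lemma utility_le_tangent w (x y : R) : 0 < x -> 0 < y ->
  U w y <= U w x + derive1 (U w) x * (y - x).
Proof.
exact: (concave_le_tangent (utility_concave hU w)
  (@utility_derivable _ _ _ _ hU w)).
Qed.

Lemma marginal_utility_antitone w (x y : R) : 0 < x -> x <= y ->
  derive1 (U w) y <= derive1 (U w) x.
Proof.
exact: (concave_derive_antitone (utility_concave hU w)
  (@utility_derivable _ _ _ _ hU w)).
Qed.

Lemma marginal_utility_gt0 w (x : R) : 0 < x -> 0 < derive1 (U w) x.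
Proof.
exact: (increasing_concave_derive_gt0 (utility_concave hU w)
  (@utility_derivable _ _ _ _ hU w) (utility_increasing hU w)).
Qed.

Lemma cvg_utility_at0 w : (U w x)%:E @[x --> 0^'+] --> utility_at0 U w.
Proof.
apply: nondecreasing_at_right_is_cvge; near=> a => x y.
rewrite !in_itv/= => /andP[x0 _] _ xy.
by rewrite lee_fin; exact: utility_nondecreasing.
Unshelve. all: by end_near. Qed.

Lemma cvg_marginal_utility_at0 w :
  (derive1 (U w) x)%:E @[x --> 0^'+] --> marginal_utility_at0 U w.
Proof.
apply: nonincreasing_at_right_is_cvge; near=> a => x y.
rewrite !in_itv/= => /andP[x0 _] _ xy.
by rewrite lee_fin; exact: marginal_utility_antitone.
Unshelve. all: by end_near. Qed.

Lemma cvg_utility_aty w : (U w x)%:E @[x --> +oo] --> utility_aty U w.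
Proof.
(* Monotonicity is available on positive arguments only; the maximum with [1] makes [f] monotone
   everywhere while agreeing with [U w] near [+oo]. *)
pose f x := (U w (Num.max x 1))%:E.
have cf : cvg (f x @[x --> +oo]).
  apply: nondecreasing_is_cvge => x y xy; rewrite lee_fin.
  apply: utility_nondecreasing; first by rewrite lt_max ltr01 orbT.
  by rewrite ge_max !le_max xy lexx orbT.
have fU : {near +oo, (fun x => (U w x)%:E) =1 f}.
  by near=> x; rewrite /f max_l//; near: x;
    apply: nbhs_pinfty_ge; exact: num_real.
apply/cvg_ex; exists (lim (f x @[x --> +oo])).
by apply: cvg_trans cf; apply: near_eq_cvg; near=> x; apply/esym; near: x.
Unshelve. all: by end_near. Qed.

Lemma utility_at0_le w (x : R) : 0 < x -> (utility_at0 U w <= (U w x)%:E)%E.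
Proof.
move=> x0; apply: (cvge_to_le (@cvg_utility_at0 w)); near=> y.
rewrite lee_fin; apply: utility_nondecreasing; near: y.
  exact: nbhs_right_gt.
exact: nbhs_right_ltW.
Unshelve. all: by end_near. Qed.

Lemma utility_le_aty w (x : R) : 0 < x -> ((U w x)%:E <= utility_aty U w)%E.
Proof.
move=> x0; apply: (cvge_to_ge (@cvg_utility_aty w)); near=> y.
by rewrite lee_fin; apply: utility_nondecreasing.
Unshelve. all: by end_near. Qed.

Lemma utility_extE w (x : R) : 0 < x -> utility_ext U w x = (U w x)%:E.
Proof. by rewrite /utility_ext => ->. Qed.

Lemma utility_ext_nondecreasing w (x y : R) : x <= y ->
  (utility_ext U w x <= utility_ext U w y)%E.
Proof.
rewrite /utility_ext; case: ifPn => x0 xy.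
  by rewrite (lt_le_trans x0 xy) lee_fin utility_nondecreasing.
by case: ifPn => // y0; exact: utility_at0_le.
Qed.

Lemma utility_ext_le_aty w (x : R) : (utility_ext U w x <= utility_aty U w)%E.
Proof.
apply: (@le_trans _ _ (U w (Num.max x 1))%:E).
  rewrite -utility_extE ?lt_max ?ltr01 ?orbT//.
  by rewrite utility_ext_nondecreasing// le_max lexx.
by rewrite utility_le_aty// lt_max ltr01 orbT.
Qed.

Lemma utility_ext_lty w (x : R) : (utility_ext U w x < +oo)%E.
Proof.
apply: (@le_lt_trans _ _ (U w (Num.max x 1))%:E); last exact: ltry.
rewrite -utility_extE ?lt_max ?ltr01 ?orbT//.
by rewrite utility_ext_nondecreasing// le_max lexx.
Qed.

(** Only [a = 0] is new: the value there is at most [U w y] for every [y > 0], and the tangent line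
    at [c] is continuous. *)
Lemma utility_ext_le_tangent w (a c : R) : 0 <= a -> 0 < c ->
  (utility_ext U w a <= (U w c + derive1 (U w) c * (a - c))%:E)%E.
Proof.
rewrite le_eqVlt => /predU1P[<- c0|a0 c0]; last first.
  by rewrite utility_extE// lee_fin utility_le_tangent.
rewrite /utility_ext ltxx; apply/lee_addgt0Pr => e e0.
have u0 := marginal_utility_gt0 w c0.
(* At this [y] the tangent line at [c] lies exactly [e] above its value at [0]. *)
pose y := e / derive1 (U w) c.
have y0 : 0 < y by rewrite divr_gt0.
apply: (le_trans (utility_at0_le w y0)).
rewrite -EFinD lee_fin (le_trans (utility_le_tangent w c0 y0))//.
have -> : e = derive1 (U w) c * y by rewrite /y mulrC divfK ?gt_eqF.
lra.
Qed.

(** Writes [utility_ext] as a limit of real utilities at positive arguments, from which its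
    measurability is obtained. *)
Lemma cvg_utility_ext w (x : R) :
  (U w (Num.max x n.+1%:R^-1))%:E @[n --> \oo] --> utility_ext U w x.
Proof.
have [x0|x0] := leP x 0; last first.
  rewrite utility_extE//; apply: cvg_near_cst; near=> n.
  rewrite max_l// ltW//; near: n.
  exact: (cvg_invS_at_right0 (nbhs_right_lt x0)).
rewrite /utility_ext ltNge x0/=.
under eq_cvg do rewrite max_r ?(le_trans x0)//.
exact: cvg_comp (@cvg_invS_at_right0 R) (@cvg_utility_at0 w).
Unshelve. all: by end_near. Qed.

Lemma measurable_utility (h : T -> R) : measurable_fun [set: T] h ->
  (forall w, 0 < h w) -> measurable_fun [set: T] (fun w => U w (h w)).
Proof.
apply: measurable_monotone_field; first exact: utility_measurable hU.
- move=> w x; rewrite in_itv/= andbT => x0.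
  have du : derivable (U w) x 1 by exact: (utility_derivable hU).
  by move/derivable1_diffP/differentiable_continuous : du.
- exact: utility_nondecreasing.
Qed.

Lemma measurable_marginal_utility (h : T -> R) : measurable_fun [set: T] h ->
  (forall w, 0 < h w) -> measurable_fun [set: T] (fun w => derive1 (U w) (h w)).
Proof.
(* Marginal utility is antitone, so the result on monotone fields is applied to its opposite. *)
move=> mh h0; rewrite -[X in measurable_fun _ X]opprK.
apply: measurableT_comp => //.
apply: (@measurable_monotone_field _ _ _ (fun w x => - derive1 (U w) x)) => //.
- move=> x x0; apply: measurableT_comp => //.
  (* Difference quotients at the fixed point [x], with step [1 / (n + 1)]. *)
  pose q n w := n.+1%:R * (U w (x + n.+1%:R^-1) - U w x).
  apply: (@measurable_fun_cvg _ _ _ _ q).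
  + move=> n; apply: measurable_funM => //; apply: measurable_funB;
      apply: (utility_measurable hU) => //; rewrite addr_gt0// invr_gt0.
  + move=> w _; have := utility_derivable hU (w := w) x0.
    rewrite derive1E => dw.
    have := cvg_comp _ _ (@cvg_invS_at_right0 R) (cvg_dnbhs_at_right dw).
    apply: cvg_trans; apply: near_eq_cvg; apply: nearW => n; rewrite /q /=.
    by rewrite invrK -[_ *: _]/(_ * _) [_%:A]mulr1 [_ + x]addrC.
- move=> w x; rewrite in_itv/= andbT => x0; apply: cvgN.
  by apply: (utility_C1 hU); rewrite in_itv/= andbT.
- by move=> w x y x0 xy; rewrite lerN2; exact: marginal_utility_antitone.
Qed.

Lemma measurable_utility_ext (h : T -> R) : measurable_fun [set: T] h ->
  measurable_fun [set: T] (fun w => utility_ext U w (h w)).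
Proof.
move=> mh; apply: (@emeasurable_fun_cvg _ _ _ _
  (fun n w => (U w (Num.max (h w) n.+1%:R^-1))%:E)).
  move=> n; apply/measurable_EFinP; apply: measurable_utility.
    exact: measurable_maxr.
  by move=> w; rewrite lt_max invr_gt0 ltr0Sn orbT.
by move=> w _; exact: cvg_utility_ext.
Qed.

Lemma measurable_utility_aty : measurable_fun [set: T] (utility_aty U).
Proof.
apply: (@emeasurable_fun_cvg _ _ _ _ (fun n w => (U w n.+1%:R)%:E)).
  by move=> n; apply/measurable_EFinP; exact: utility_measurable.
move=> w _; apply: cvg_comp (@cvg_utility_aty w).
apply/cvgryPge => A; have /cvgryPge/(_ A) := @cvgr_idn R.
by apply: filterS => n /le_trans; apply; rewrite ler_nat.
Qed.

Lemma measurable_marginal_utility_at0 :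
  measurable_fun [set: T] (marginal_utility_at0 U).
Proof.
apply: (@emeasurable_fun_cvg _ _ _ _
  (fun n w => (derive1 (U w) n.+1%:R^-1)%:E)).
  by move=> n; apply/measurable_EFinP; apply: measurable_marginal_utility.
by move=> w _; exact: cvg_comp (@cvg_invS_at_right0 R)
  (@cvg_marginal_utility_at0 w).
Qed.

End utility_field_theory.

(** * Equivalent probabilities given by a positive density *)

Lemma exists_density_probability d (T : measurableType d) (R : realType)
    (P : probability T R) (z : T -> R) :
  measurable_fun [set: T] z -> (forall w, 0 < z w) ->
  (\int[P]_w (z w)%:E = 1)%E ->
  exists Q : probability T R, [/\ P `<< Q, Q `<< P &
    forall h : T -> \bar R, measurable_fun [set: T] h ->
      (forall w, 0 <= h w)%E ->
      (\int[Q]_w h w = \int[P]_w (h w * (z w)%:E))%E].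
Proof.
move=> mz z0 z1.
have mZ : measurable_fun [set: T] (EFin \o z) by exact/measurable_EFinP.
pose nu A := (\int[P]_(w in A) (z w)%:E)%E.
have nu0 : nu set0 = 0%E by exact: integral_set0.
have nu_ge0 A : (0 <= nu A)%E.
  by apply: integral_ge0 => w _; rewrite lee_fin ltW.
have nu_sigma : semi_sigma_additive nu.
  move=> A mA tA mUA; rewrite /nu ge0_integral_bigcup//.
  - apply: is_cvg_ereal_nneg_natsum_cond => n _ _; exact: nu_ge0.
  - exact: measurable_funTS.
  - by move=> w _; rewrite lee_fin ltW.
pose isM := isMeasure.Build _ _ _ nu nu0 nu_ge0 nu_sigma.
pose M : {measure set T -> \bar R} := HB.pack nu isM.
pose isP := @Measure_isProbability.Build _ _ R M z1.
pose Q : probability T R := HB.pack nu isM isP.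
have QE A : Q A = (\int[P]_(w in A) (z w)%:E)%E by [].
have QP : Q `<< P.
  apply/null_content_dominatesP => A mA PA0; rewrite QE.
  by apply: null_set_integral => //; exact: measurable_funTS.
exists Q; split=> [|//|h mh h0].
  (* If [Q A = 0] then [z = 0] almost everywhere on [A]; as [z > 0], the set [A] is [P]-null. *)
  apply/null_content_dominatesP => A mA QA0.
  have {}QA0 : nu A = 0%E by exact: QA0.
  apply/(negligibleP _ mA).
  have : ae_eq P A (EFin \o z) (cst 0%E).
    apply/(ae_eq_integral_abs _ mA); first exact: measurable_funTS.
    rewrite -[RHS]QA0; apply: eq_integral => w _.
    by rewrite gee0_abs// lee_fin ltW.
  apply: negligibleS => w Aw /(_ Aw) [] /eqP.
  by rewrite gt_eqF.
(* Integrals change variables through the Radon-Nikodym derivative [D], which equals [z] almost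
   everywhere: both have the same integral over every measurable set. *)
pose D := Radon_Nikodym_SigmaFinite.f Q P.
rewrite -(@Radon_Nikodym_SigmaFinite.change_of_variables _ _ _ Q P)//.
have iD := Radon_Nikodym_SigmaFinite.f_integrable QP.
apply: ae_eq_integral => //.
- apply: emeasurable_funM => //; exact: measurable_int iD.
- exact: emeasurable_funM.
have : ae_eq P [set: T] D (EFin \o z).
  apply: integral_ae_eq => // A _ mA.
  by rewrite -Radon_Nikodym_SigmaFinite.f_integral.
by apply: filterS => w /(_ I) Dz _; rewrite -/D Dz.
Qed.

(** * Expected utility through representatives, and its integrability *)

Section expected_utility_theory.
Context d (T : measurableType d) (R : realType) (P : probability T R).
Variable U : T -> R -> R.
Hypothesis hU : utility_field U.

(** Lets the chosen representative of a class be replaced by one with pointwise sign properties. *)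
Lemma expected_utilityE (f : L0 P) (h : T -> R) : measurable_fun [set: T] h ->
  {ae P, forall w, f w = h w} ->
  expected_utility U f = (\int[P]_w utility_ext U w (h w))%E.
Proof.
move=> mh fh; apply: ae_eq_integral => //.
- exact/measurable_utility_ext/L0_measurable.
- exact: measurable_utility_ext.
- by apply: filterS fh => w -> _.
Qed.

Hypothesis hy : (\int[P]_w Order.max 0 (utility_aty U w) < +oo)%E.

(** The positive part is below [Order.max 0 (utility_aty U w)], hence integrable, so a negative part
    of infinite integral would give [-oo]. *)
Lemma integrable_utility_ext (h : T -> R) : measurable_fun [set: T] h ->
  (-oo < \int[P]_w utility_ext U w (h w))%E ->
  P.-integrable [set: T] (fun w => utility_ext U w (h w)).
Proof.
move=> mh; set V := fun w => _.
have mV : measurable_fun [set: T] V by exact: measurable_utility_ext.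
have Vp : (\int[P]_w V^\+ w < +oo)%E.
  apply: le_lt_trans hy; apply: ge0_le_integral => //.
  - exact: measurable_funepos.
  - apply: measurable_maxe => //; exact: measurable_utility_aty.
  - move=> w _; rewrite funeposE maxC ge_max !le_max lexx/=.
    by rewrite (utility_ext_le_aty hU) orbT.
rewrite integralE => Vy; apply/integrableP; split=> //.
rewrite -/(abse \o V) fune_abse ge0_integralD//; last 2 first.
  exact: measurable_funepos.
  exact: measurable_funeneg.
rewrite lte_add_pinfty// ltNge leye_eq; apply/eqP => Vn.
by move: Vy; rewrite Vn addeNy.
Qed.

End expected_utility_theory.

(** * Increments of utility along a segment *)

Section utility_increments.
Context d (T : measurableType d) (R : realType).
Variable U : T -> R -> R.
Hypothesis hU : utility_field U.
Implicit Types (w : T) (a b e x y : R).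

(** [fine] sends [-oo] to [0], so [v] is meaningful only where the extended utility is finite. *)
Let v w x := fine (utility_ext U w x).

Lemma fin_num_utility_ext w x y : (-oo < utility_ext U w x)%E -> x <= y ->
  utility_ext U w y \is a fin_num.
Proof.
move=> Vx xy; rewrite fin_real// (utility_ext_lty hU) andbT.
exact: lt_le_trans Vx (utility_ext_nondecreasing hU w xy).
Qed.

(** The tangent at the intermediate point [c] is evaluated at [a], where [a - c = - e (b - a)]. As
    [c > 0], this covers [a = 0]. *)
Lemma utility_increment_ge w a b e : 0 <= a -> 0 < (1 - e) * a + e * b ->
  (-oo < utility_ext U w a)%E ->
  e * (derive1 (U w) ((1 - e) * a + e * b) * (b - a)) <=
  v w ((1 - e) * a + e * b) - v w a.
Proof.
set c := _ + _ => a0 c0 Va.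
have := utility_ext_le_tangent hU w a0 c0.
rewrite -(fineK (fin_num_utility_ext Va (lexx a))) lee_fin -/(v w a).
rewrite /v [in X in _ -> _ <= X - _]utility_extE//=.
have -> : a - c = - (e * (b - a)) by rewrite /c; ring.
by rewrite mulrN mulrCA; lra.
Qed.

(* The loss [U(g) - U((1 - e) g + e f)] is at most [e] times this integrable
   quantity, uniformly in [e <= 1/2] and [f]. *)
Definition half_increment w a : R := 4 * (v w (a / 2) - v w (a / 4)).

(** The tangent at [a / 2] drops by [a / 4] times its slope on the way to [a / 4]; hence the factor
    [4] in [half_increment]. *)
Lemma marginal_utility_le_half_increment w a : 0 < a ->
  derive1 (U w) (a / 2) * a <= half_increment w a.
Proof.
move=> a0; have a2 : 0 < a / 2 by rewrite divr_gt0.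
have a4 : 0 < a / 4 by rewrite divr_gt0.
have := utility_le_tangent hU w a2 a4.
rewrite /half_increment /v !utility_extE//=; lra.
Qed.

Lemma half_increment_ge0 w a : 0 <= a -> (-oo < utility_ext U w (a / 4))%E ->
  0 <= half_increment w a.
Proof.
move=> a0 Va; rewrite mulr_ge0// subr_ge0 fine_le//.
- by apply: fin_num_utility_ext Va _.
- by apply: fin_num_utility_ext Va _; lra.
- by apply: utility_ext_nondecreasing => //; lra.
Qed.

(** With [e <= 1 / 2] the intermediate point is at least [a / 2], so the slope there is at most the
    slope at [a / 2]; and [b >= 0] gives [a - b <= a]. *)
Lemma utility_loss_le w a b e : 0 <= a -> 0 <= b -> 0 < e -> e <= 1 / 2 ->
  (-oo < utility_ext U w (a / 4))%E ->
  - (e * half_increment w a) <= v w ((1 - e) * a + e * b) - v w a.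
Proof.
move=> a0 b0 e0 e2 Va; have a4 : a / 4 <= a by lra.
have Vaa : (-oo < utility_ext U w a)%E.
  exact: lt_le_trans Va (utility_ext_nondecreasing hU w a4).
have ab : 0 <= (1 - e) * a by rewrite mulr_ge0//; lra.
have eb : 0 <= e * b by rewrite mulr_ge0// ltW.
(* For [a = 0] the perturbation can only raise the argument, so the increment is nonnegative. *)
move: a0; rewrite le_eqVlt => /predU1P[a0|a0].
  rewrite (@le_trans _ _ 0)//.
    rewrite oppr_le0 mulr_ge0 ?(ltW e0)// half_increment_ge0//.
    by rewrite -a0.
  rewrite subr_ge0 fine_le//.
  - exact: fin_num_utility_ext Vaa _.
  - by apply: fin_num_utility_ext Vaa _; rewrite -a0; lra.
  - by apply: utility_ext_nondecreasing => //; lra.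
have c2 : a / 2 <= (1 - e) * a + e * b.
  have : e * a <= 1 / 2 * a by rewrite ler_pM2r.
  lra.
have c0 : 0 < (1 - e) * a + e * b by apply: lt_le_trans c2; rewrite divr_gt0.
apply: le_trans (utility_increment_ge (ltW a0) c0 Vaa).
rewrite -mulrN ler_pM2l// lerNl -mulrN opprB.
apply: le_trans (marginal_utility_le_half_increment w a0).
have a2 : 0 < a / 2 by rewrite divr_gt0.
have u1 := marginal_utility_antitone hU w a2 c2.
have u0 := marginal_utility_gt0 hU w c0.
apply: (@le_trans _ _ (derive1 (U w) ((1 - e) * a + e * b) * a)).
  by rewrite ler_pM2l//; lra.
by rewrite ler_pM2r.
Qed.

End utility_increments.

(** * Lower limits of sequences and integrability criteria *)

Lemma measurable_fun_limn_einf d (T : measurableType d) (R : realType)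
    (D : set T) (f : (T -> \bar R)^nat) :
  (forall n, measurable_fun D (f n)) ->
  measurable_fun D (fun w => limn_einf (f ^~ w)).
Proof.
move=> mf; rewrite (_ : (fun w => _) =
    (fun w => - limn_esup ((fun n => \- f n)^~ w))%E).
  apply: measurableT_comp => //; apply: measurable_fun_limn_esup => n.
  exact: measurableT_comp.
by apply/funext => w; rewrite -[RHS]oppeK -limn_einfN oppeK; congr limn_einf;
  apply/funext => n /=; rewrite oppeK.
Qed.

Lemma limn_einf_le_ub (R : realType) (u : (\bar R)^nat) (l : \bar R) :
  (forall n, u n <= l)%E -> (limn_einf u <= l)%E.
Proof.
move=> ul; rewrite limn_einf_lim; apply: lime_le; first exact: is_cvg_einfs.
apply: nearW => n; apply: le_trans (ul n).
by apply: ereal_inf_lbound; exists n => /=.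
Qed.

Lemma limn_einf_ge_cvg (R : realType) (u v : (\bar R)^nat) (l : \bar R) :
  (forall n, v n <= u n)%E -> v @ \oo --> l -> (l <= limn_einf u)%E.
Proof.
move=> vu vl; have [<- _] := cvg_limn_einf_sup vl.
rewrite !limn_einf_lim; apply: lee_lim; [exact/is_cvg_einfs..|].
apply: nearW => n; apply: le_ereal_inf_tmp => _ [m /= nm <-].
by apply: le_trans (vu m); apply: ereal_inf_lbound; exists m.
Qed.

Lemma integrable_fine d (T : measurableType d) (R : realType)
    (mu : {measure set T -> \bar R}) (D : set T) (f : T -> \bar R) :
  measurable D -> mu.-integrable D f ->
  mu.-integrable D (EFin \o fine \o f) /\
  (\int[mu]_(w in D) (fine (f w))%:E = \int[mu]_(w in D) f w)%E.
Proof.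
move=> mD intf; have mf := measurable_int _ intf.
have mff : measurable_fun D (EFin \o fine \o f).
  by apply/measurable_EFinP; exact: measurableT_comp.
split.
  apply: le_integrable intf => // w _ /=.
  by case: (f w) => [r| |] /=; rewrite ?lexx ?leey.
apply: ae_eq_integral => //.
by apply: filterS (integrable_ae mD intf) => w fw Dw; rewrite fineK// fw.
Qed.

(** [|f|] is bounded by [|u|] where [f >= 0] and by [|l|] where [f < 0]. *)
Lemma integrable_between d (T : measurableType d) (R : realType)
    (mu : {measure set T -> \bar R}) (D : set T) (f l u : T -> \bar R) :
  measurable D -> measurable_fun D f ->
  mu.-integrable D l -> mu.-integrable D u ->
  (forall w, D w -> (l w <= f w <= u w)%E) -> mu.-integrable D f.
Proof.
move=> mD mf il iu luf.
apply: (@le_integrable _ _ _ _ _ mD _ ((abse \o l) \+ (abse \o u))%E) => //.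
  move=> w /luf /andP[lf fu]; rewrite /= [leRHS]gee0_abs ?adde_ge0//.
  have [f0|f0] := leP 0%E (f w).
    by rewrite gee0_abs// (le_trans fu)// (le_trans (lee_abs _))// leeDr.
  rewrite lte0_abs// (@le_trans _ _ (- l w)%E) ?leeN2//.
  by rewrite -abseN (le_trans (lee_abs _))// leeDl.
by apply: integrableD => //; exact: integrable_abse.
Qed.

Lemma integrable_max0_utility_aty d (T : measurableType d) (R : realType)
    (P : probability T R) (U : T -> R -> R) : utility_field U ->
  (\int[P]_w Order.max 0 (utility_aty U w) < +oo)%E ->
  P.-integrable [set: T] (fun w => Order.max 0 (utility_aty U w))%E.
Proof.
move=> hU hy; apply/integrableP; split.
  by apply: measurable_maxe => //; exact: measurable_utility_aty.
by under eq_integral do rewrite gee0_abs ?le_max ?lexx//.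
Qed.

Lemma cvg_at_right_gt (R : realType) (I : Type) (F : set_system I)
    (f : I -> R) (l : R) : Filter F ->
  (forall i, l < f i) -> f i @[i --> F] --> l -> f i @[i --> F] --> l^'+.
Proof.
move=> FF lf /cvgrPdist_lt fl A [e/= e0 eA].
by have := fl _ e0; apply: filterS => i /= fe; apply: eA.
Qed.

(** * Perturbation of an optimizer: Fatou's lemma and first-order conditions *)

Section optimality.
Context d (T : measurableType d) (R : realType) (P : probability T R).
Variable U : T -> R -> R.
Hypothesis hU : utility_field U.
Hypothesis hy : (\int[P]_w Order.max 0 (utility_aty U w) < +oo)%E.
Variables a b : T -> R.
Hypotheses (ma : measurable_fun [set: T] a) (mb : measurable_fun [set: T] b).
Hypotheses (a_ge0 : forall w, 0 <= a w) (b_ge0 : forall w, 0 <= b w).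
Hypothesis Ua4 : (-oo < \int[P]_w utility_ext U w (a w / 4))%E.
Hypothesis a_optimal : forall e, 0 < e -> e < 1 ->
  (\int[P]_w utility_ext U w ((1 - e) * a w + e * b w) <=
   \int[P]_w utility_ext U w (a w))%E.

Let v h w := fine (utility_ext U w (h w)).
Let D w := half_increment U w (a w).
(** Starting at [1 / 2] keeps every [e n] in the range of [utility_loss_le]. *)
Let e n : R := n.+2%:R^-1.
Let c n w := (1 - e n) * a w + e n * b w.
(** Adding [D] makes the quotient nonnegative almost everywhere; the maximum makes it so everywhere,
    as Fatou's lemma is applied to pointwise nonnegative functions. *)
Let G n w := Num.max 0 ((e n)^-1 * (v (c n) w - v a w) + D w).

Let e_gt0 n : 0 < e n. Proof. by rewrite invr_gt0. Qed.

Let e_le12 n : e n <= 1 / 2.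
Proof. by rewrite div1r lef_pV2 ?posrE// ler_nat. Qed.

Let mc n : measurable_fun [set: T] (c n).
Proof. by apply: measurable_funD; apply: measurable_funM. Qed.

Let int_ext h : measurable_fun [set: T] h -> (forall w, a w / 4 <= h w) ->
  P.-integrable [set: T] (fun w => utility_ext U w (h w)).
Proof.
move=> mh ah; have ma4 : measurable_fun [set: T] (fun w => a w / 4).
  exact: measurable_funM.
apply: (integrable_between _ _ (integrable_utility_ext hU hy ma4 Ua4)
  (integrable_max0_utility_aty hU hy)) => //.
  exact: measurable_utility_ext.
move=> w _; rewrite (utility_ext_nondecreasing hU)//=.
by rewrite le_max (utility_ext_le_aty hU) orbT.
Qed.

Let ma_ (r : R) : measurable_fun [set: T] (fun w => a w / r).
Proof. exact: measurable_funM. Qed.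

Let int_a4 : P.-integrable [set: T] (fun w => utility_ext U w (a w / 4)).
Proof. exact: int_ext. Qed.

Let c_ge n w : a w / 4 <= c n w.
Proof.
have : (1 / 2) * a w <= (1 - e n) * a w.
  by rewrite ler_wpM2r//; have := e_le12 n; lra.
have : 0 <= e n * b w by rewrite mulr_ge0// ltW.
by have := a_ge0 w; rewrite /c; lra.
Qed.

Let a4_ae : {ae P, forall w, -oo < utility_ext U w (a w / 4)}%E.
Proof.
have := integrable_ae measurableT int_a4; apply: filterS => w /(_ I).
by rewrite fin_numE => /andP[]; rewrite ltNye.
Qed.

Let int_v h : measurable_fun [set: T] h -> (forall w, a w / 4 <= h w) ->
  P.-integrable [set: T] (EFin \o v h) /\
  (\int[P]_w (v h w)%:E = \int[P]_w utility_ext U w (h w))%E.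
Proof. by move=> mh ah; apply: integrable_fine => //; exact: int_ext. Qed.

Lemma integrable_half_increment : P.-integrable [set: T] (EFin \o D).
Proof.
have [|i2 _] := int_v (ma_ 2); first by move=> w; have := a_ge0 w; lra.
have [|i4 _] := int_v (ma_ 4); first by [].
rewrite (_ : _ \o _ = (fun w => 4%:E *
  ((EFin \o v (fun w => a w / 2)%R) w -
     (EFin \o v (fun w => a w / 4)%R) w)))%E//.
by apply: integrableZl => //; exact: integrableB.
Qed.

Let mv h : measurable_fun [set: T] h -> measurable_fun [set: T] (v h).
Proof.
by move=> mh; apply: measurableT_comp => //; exact: measurable_utility_ext.
Qed.

Let mG n : measurable_fun [set: T] (G n).
Proof.
apply: measurable_maxr => //; apply: measurable_funD; last first.
  exact/measurable_EFinP/measurable_int/integrable_half_increment.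
by apply: measurable_funM => //; apply: measurable_funB; exact: mv.
Qed.

(** Almost everywhere [G n] is the quotient plus [D], and optimality makes the expectation of the
    quotient nonpositive. *)
Let G_le n : (\int[P]_w (G n w)%:E <= \int[P]_w (D w)%:E)%E.
Proof.
have [ic Ec] := int_v (mc n) (c_ge n).
have [|ia Ea] := int_v ma; first by move=> w; have := a_ge0 w; lra.
have iD := integrable_half_increment.
pose H w := ((e n)^-1%:E * ((v (c n) w)%:E - (v a w)%:E) + (D w)%:E)%E.
have iB := integrableB measurableT ic ia.
have iZ := integrableZl measurableT (e n)^-1 iB.
have mH : measurable_fun [set: T] H.
  exact: measurable_int (integrableD measurableT iZ iD).
rewrite (_ : (\int[P]_w (G n w)%:E = \int[P]_w H w)%E); last first.
  apply: ae_eq_integral => //.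
    exact/measurable_EFinP.
  apply: filterS a4_ae => w Va _; congr EFin; apply: max_r.
  have := utility_loss_le hU (a_ge0 w) (b_ge0 w) (e_gt0 n) (e_le12 n) Va.
  rewrite -/(D w) -[fine _ - _]/(v (c n) w - v a w).
  rewrite -(ler_pM2l (_ : 0 < (e n)^-1)) ?invr_gt0//.
  rewrite mulrN mulKf ?gt_eqF//; lra.
rewrite integralD// integralZl// integralB// [X in (_ * X)%E](_ : _ =
  (\int[P]_w (v (c n) w)%:E - \int[P]_w (v a w)%:E))%E//.
rewrite -[leRHS]add0e; apply: leeD2r.
rewrite Ec Ea mule_ge0_le0 ?lee_fin ?invr_ge0 ?(ltW (e_gt0 _))//.
rewrite sube_le0//.
by apply: a_optimal => //; have := e_le12 n; lra.
Qed.

Lemma increment_quotient_liminf :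
  (\int[P]_w limn_einf (fun n => (G n w)%:E) <= \int[P]_w (D w)%:E)%E.
Proof.
apply: (@le_trans _ _ (limn_einf (fun n => \int[P]_w (G n w)%:E)%E)).
  apply: fatou => //; last by move=> n w _; rewrite lee_fin le_max lexx.
  by move=> n; exact/measurable_EFinP.
exact: limn_einf_le_ub.
Qed.

Let int_D_lty : (\int[P]_w (D w)%:E < +oo)%E.
Proof. exact: integrable_lty integrable_half_increment. Qed.

Let cvg_e : e n @[n --> \oo] --> 0.
Proof. by have := @cvg_harmonic R; rewrite -cvg_shiftS. Qed.

Let cvg_eM r : e n * r @[n --> \oo] --> 0.
Proof. by rewrite -(mul0r r); apply: cvgMr_tmp; exact: cvg_e. Qed.

Let G_ge n w : 0 < c n w -> (-oo < utility_ext U w (a w / 4))%E ->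
  derive1 (U w) (c n w) * (b w - a w) + D w <= G n w.
Proof.
move=> c0 Va; rewrite le_max lerD2r; apply/orP; right.
have Vaa : (-oo < utility_ext U w (a w))%E.
  apply: lt_le_trans Va (utility_ext_nondecreasing hU w _).
  by have := a_ge0 w; lra.
rewrite ler_pdivlMl//.
exact: utility_increment_ge.
Qed.

(** The lower limit [L] is integrable, hence finite almost everywhere, which excludes
    [a w = 0 < b w]. *)
Lemma optimal_gt0 : {ae P, forall w, 0 < b w} ->
  {ae P, forall w, marginal_utility_at0 U w = +oo%E} ->
  {ae P, forall w, 0 < a w}.
Proof.
move=> b0 inada; pose L w := limn_einf (fun n => (G n w)%:E).
have L0 w : (0 <= L w)%E.
  apply: (@limn_einf_ge_cvg _ _ (cst 0%E)); last exact: cvg_cst.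
  by move=> n; rewrite lee_fin le_max lexx.
have iL : P.-integrable [set: T] L.
  apply/integrableP; split.
    by apply: measurable_fun_limn_einf => n; exact/measurable_EFinP.
  under eq_integral do rewrite gee0_abs//.
  exact: le_lt_trans increment_quotient_liminf int_D_lty.
have := integrable_ae measurableT iL.
apply: filterS3 b0 (filterI inada a4_ae) => w bw0 [Uw Va] /(_ I) Lw.
rewrite lt_neqAle a_ge0 andbT; apply/eqP => aw0.
have cE n : c n w = e n * b w by rewrite /c -aw0 mulr0 add0r.
have c0 n : 0 < c n w by rewrite cE mulr_gt0.
suff Ly : (+oo <= L w)%E by move: Lw Ly; rewrite leye_eq => /[swap] /eqP ->.
(* Here [c n w = e n * b w] tends to [0] from the right, so these lower bounds of [G n w] tend to
   [+oo]. *)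
apply: (@limn_einf_ge_cvg _ _ (fun n => (derive1 (U w) (c n w) * b w)%:E)).
  move=> n; rewrite lee_fin; apply: le_trans (G_ge (c0 n) Va).
  by rewrite -aw0 subr0 lerDl half_increment_ge0// -aw0.
have cc : c n w @[n --> \oo] --> 0^'+.
  apply: cvg_at_right_gt => //.
  by under eq_cvg do rewrite cE; exact: cvg_eM.
have := cvg_comp _ _ cc (cvg_marginal_utility_at0 hU (w := w)).
rewrite Uw => /cvgeyPge Uy; apply/cvgeyPge => A.
apply: filterS (Uy (A / b w)) => n /=.
by rewrite !lee_fin ler_pdivrMr.
Qed.

Lemma first_order_condition : (forall w, 0 < a w) ->
  (\int[P]_w (derive1 (U w) (a w) * b w)%:E <=
   \int[P]_w (derive1 (U w) (a w) * a w)%:E)%E /\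
  (\int[P]_w (derive1 (U w) (a w) * a w)%:E < +oo)%E.
Proof.
move=> a_gt0.
pose u w := derive1 (U w) (a w).
have mu : measurable_fun [set: T] u by exact: measurable_marginal_utility.
have u0 w : 0 < u w by exact: marginal_utility_gt0.
have mD : measurable_fun [set: T] D.
  exact/measurable_EFinP/measurable_int/integrable_half_increment.
have mua : measurable_fun [set: T] (fun w => u w * a w).
  exact: measurable_funM.
(* The slope at [a] is at most the slope at [a / 2]; finiteness of the integral of [u a] follows
   from that of [D]. *)
have uaD w : u w * a w <= D w.
  apply: le_trans (marginal_utility_le_half_increment hU w (a_gt0 w)).
  rewrite ler_pM2r//; apply: (marginal_utility_antitone hU).
    by rewrite divr_gt0.
  by have := a_gt0 w; lra.
have ua_lty : (\int[P]_w (u w * a w)%:E < +oo)%E.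
  apply: le_lt_trans int_D_lty; apply: ge0_le_integral => //.
  - by move=> w _; rewrite lee_fin mulr_ge0// ltW.
  - exact/measurable_EFinP.
  - exact/measurable_EFinP.
  - by move=> w _; rewrite lee_fin.
split=> //.
(* Adding [K] to both sides keeps all integrands nonnegative: the right one becomes [D], the left
   one [u (b - a) + D], which is the limit of the lower bounds [G_ge]. *)
pose K w := D w - u w * a w.
have mK : measurable_fun [set: T] K by exact: measurable_funB.
have K0 w : 0 <= K w by rewrite subr_ge0.
have K_lty : (\int[P]_w (K w)%:E < +oo)%E.
  apply: le_lt_trans int_D_lty; apply: ge0_le_integral => //.
  - by move=> w _; rewrite lee_fin.
  - exact/measurable_EFinP.
  - exact/measurable_EFinP.
  - by move=> w _; rewrite lee_fin gerBl mulr_ge0// ltW.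
have K_fin : (\int[P]_w (K w)%:E)%E \is a fin_num.
  by rewrite ge0_fin_numE// integral_ge0// => w _; rewrite lee_fin.
rewrite -(leeD2rE _ _ K_fin) -!ge0_integralD//; first last.
- exact/measurable_EFinP.
- by move=> w _; rewrite lee_fin.
- by apply/measurable_EFinP; exact: measurable_funM.
- by move=> w _; rewrite lee_fin -/(u w) mulr_ge0// ltW.
- exact/measurable_EFinP.
- by move=> w _; rewrite lee_fin.
- exact/measurable_EFinP.
- by move=> w _; rewrite lee_fin -/(u w) mulr_ge0// ltW.
rewrite [leRHS](_ : _ = \int[P]_w (D w)%:E)%E; last first.
  by apply: eq_integral => w _; rewrite -EFinD /K addrC subrK.
apply: le_trans increment_quotient_liminf.
apply: ge0_le_integral => //.
- by move=> w _; rewrite -EFinD lee_fin addr_ge0// -/(u w) mulr_ge0// ltW.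
- apply: emeasurable_funD; apply/measurable_EFinP => //.
  exact: measurable_funM.
- by apply: measurable_fun_limn_einf => n; exact/measurable_EFinP.
move=> w _; have Va : (-oo < utility_ext U w (a w / 4))%E.
  by rewrite utility_extE ?ltNyr// divr_gt0.
have c0 n : 0 < c n w by apply: lt_le_trans (c_ge n w); rewrite divr_gt0.
apply: (@limn_einf_ge_cvg _ _
    (fun n => (derive1 (U w) (c n w) * (b w - a w) + D w)%:E)).
  by move=> n; rewrite lee_fin G_ge.
have -> : ((u w * b w)%:E + (K w)%:E)%E = (u w * (b w - a w) + D w)%:E.
  by rewrite -EFinD /K; congr EFin; ring.
apply: cvg_EFin; first exact: nearW.
apply: cvgD; last exact: cvg_cst.
apply: cvgMr_tmp.
have cc : c n w @[n --> \oo] --> a w.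
  rewrite /c -[X in _ --> X]addr0; apply: cvgD.
    rewrite -[X in _ --> X]mul1r; apply: cvgMr_tmp.
    rewrite -[X in _ --> X]subr0; apply: cvgB => //; exact: cvg_cst.
  exact: cvg_eM.
apply: cvg_comp cc _; apply: (utility_C1 hU).
by rewrite in_itv/= andbT.
Qed.

End optimality.

(** * Measurability of inversion and almost sure properties *)

Lemma measurable_invr (R : realType) : measurable_fun [set: R] (@GRing.inv R).
Proof.
rewrite -(setUv [set (0 : R)]).
apply/measurable_funU => //; first exact: measurableC.
split; first exact: measurable_fun_set1.
apply: open_continuous_measurable_fun.
  exact/closed_openC/closed_eq.
by move=> x; rewrite inE/= => /eqP x0; exact: inv_continuous.
Qed.

Lemma L0_nneg_max0 d (T : measurableType d) (R : realType)
    (P : probability T R) (f : L0 P) : L0_nneg P f ->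
  {ae P, forall w, f w = Num.max (f w) 0}.
Proof. by apply: filterS => w f0; rewrite max_l. Qed.

Lemma marginal_utility_at0_ae d (T : measurableType d) (R : realType)
    (P : probability T R) (U : T -> R -> R) : utility_field U ->
  P [set w | marginal_utility_at0 U w = +oo%E] = 1%E ->
  {ae P, forall w, marginal_utility_at0 U w = +oo%E}.
Proof.
move=> hU; set A := [set w | _] => PA.
have mA : measurable A.
  have := measurable_marginal_utility_at0 hU measurableT
    (emeasurable_set1 +oo%E).
  by rewrite setTI.
exists (~` A); split=> //; first exact: measurableC.
by rewrite probability_setC// PA subee.
Qed.

(** A vanishing integral would force [f = 0] almost everywhere, making the whole space null. *)
Lemma integral_gt0_ae d (T : measurableType d) (R : realType)
    (P : probability T R) (f : T -> \bar R) : measurable_fun [set: T] f ->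
  (forall w, 0 < f w)%E -> (0 < \int[P]_w f w)%E.
Proof.
move=> mf f0; rewrite lt_neqAle integral_ge0 ?andbT; last first.
  by move=> w _; rewrite ltW.
apply/eqP => If; have : (\int[P]_w `|f w| = 0)%E.
  by rewrite If; apply: eq_integral => w _; rewrite gee0_abs// ltW.
move/(ae_eq_integral_abs _ measurableT mf) => [A [mA PA0 sA]].
have : (P [set: T] <= P A)%E.
  apply: le_measure; rewrite ?inE// => w _; apply: sA => /= /(_ I).
  by apply/eqP; rewrite gt_eqF.
by rewrite PA0 probability_setT leNgt lte01.
Qed.

(** * Optimality of [g] in [C], read on representatives *)

Section numeraire.
Context d (T : measurableType d) (R : realType) (P : probability T R).
Variables (U : T -> R -> R) (C : set (L0 P)) (g : L0 P).
Hypothesis hU : utility_field U.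
Hypothesis hy : (\int[P]_w Order.max 0 (utility_aty U w) < +oo)%E.
Hypothesis convC : convex_set C.
Hypothesis Cg : C g.
Hypothesis g_sup : expected_utility U g = ereal_sup (expected_utility U @` C).

(** By convexity [k] lies in [C], and [(1 - e) a + e b] represents it. *)
Lemma expected_utility_optimal (f : L0 P) (a b : T -> R) : C f ->
  measurable_fun [set: T] a -> measurable_fun [set: T] b ->
  {ae P, forall w, g w = a w} -> {ae P, forall w, f w = b w} ->
  forall e, 0 < e -> e < 1 ->
  (\int[P]_w utility_ext U w ((1 - e) * a w + e * b w) <=
   \int[P]_w utility_ext U w (a w))%E.
Proof.
move=> Cf ma mb gma fmb e e0 e1.
rewrite -(expected_utilityE hU ma gma).
pose k : L0 P := e *: f + (1 - e) *: g.
have Ck : C k.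
  have := convC (Itv01 (ltW e0) (ltW e1)) (mem_set Cf) (mem_set Cg).
  by move/set_mem.
have mk : measurable_fun [set: T] (fun w => (1 - e) * a w + e * b w).
  by apply: measurable_funD; apply: measurable_funM.
rewrite -(@expected_utilityE _ _ _ _ _ hU k _ mk).
  by rewrite g_sup; apply: ereal_sup_ubound; exists k.
apply: filterS (filterI (L0_addE (e *: f) ((1 - e) *: g))
  (filterI (L0_scaleE e f) (filterI (L0_scaleE (1 - e) g)
  (filterI gma fmb)))) => w [-> [-> [-> [-> ->]]]].
by rewrite addrC.
Qed.

Hypothesis g_a : forall a : R, 0 < a -> a < 1 ->
  (-oo < expected_utility U (a *: g))%E.

(** The factor [1 / 4] is the smaller of the two in [half_increment]. *)
Lemma expected_utility_quarter (a : T -> R) : measurable_fun [set: T] a ->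
  {ae P, forall w, g w = a w} ->
  (-oo < \int[P]_w utility_ext U w (a w / 4))%E.
Proof.
move=> ma gma; have -> : (\int[P]_w utility_ext U w (a w / 4) =
    expected_utility U (4^-1 *: g))%E.
  apply/esym/(expected_utilityE hU); first exact: measurable_funM.
  apply: filterS (filterI (L0_scaleE 4^-1 g) gma) => w [-> ->].
  by rewrite mulrC.
by apply: g_a; lra.
Qed.

End numeraire.

(** * Construction of the equivalent probability *)

Theorem mainTheorem3 (d : measure_display) (T : measurableType d)
    (R : realType) (P : probability T R) (U : T -> R -> R)
    (C : set (L0 P)) (g : L0 P) :
  utility_field U ->
  P [set w | marginal_utility_at0 U w = +oo%E] = 1%E ->
  (\int[P]_w Order.max 0 (utility_aty U w) < +oo)%E ->
  C `<=` L0_nneg P ->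
  convex_set C ->
  max_closed C ->
  L0_bounded C ->
  C `&` L0_pos P !=set0 ->
  maximal C g ->
  expected_utility U g = ereal_sup (expected_utility U @` C) ->
  (ereal_sup (expected_utility U @` C) < +oo)%E ->
  (forall a : R, 0 < a -> a < 1 -> (-oo < expected_utility U (a *: g))%E) ->
  numeraire C g.
Proof.
move=> hU inada hy C_ge0 convC _ _ [f0 [Cf0 f0_gt0]] [Cg _] g_sup _ g_a.
(* For [f] in [C] this is a representative that is nonnegative at every point. *)
have mmax (f : L0 P) : measurable_fun [set: T] (fun w => Num.max (f w) 0).
  by apply: measurable_maxr => //; exact: L0_measurable.
have max_ge0 (f : L0 P) w : 0 <= Num.max (f w) 0 by rewrite le_max lexx orbT.
have g_gt0 : L0_pos P g.
  have gE := L0_nneg_max0 (C_ge0 _ Cg).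
  have max_gt0 : {ae P, forall w, 0 < Num.max (g w) 0}.
    apply: (@optimal_gt0 _ _ _ _ _ hU hy _ (fun w => Num.max (f0 w) 0)) => //.
    - exact: (expected_utility_quarter hU g_a (mmax g) gE).
    - exact: (expected_utility_optimal hU convC Cg g_sup Cf0 (mmax g) (mmax f0)
        gE (L0_nneg_max0 (C_ge0 _ Cf0))).
    - by apply: filterS f0_gt0 => w f0w; rewrite lt_max f0w.
    - exact: marginal_utility_at0_ae.
  by apply: filterS max_gt0 => w; rewrite lt_max ltxx orbF.
split=> //.
(* Now that [g > 0] almost surely, it has a representative positive everywhere; the value [1] is
   taken on a null set only. *)
pose a w := if 0 < g w then g w else 1.
have ma : measurable_fun [set: T] a.
  apply: measurable_fun_ifT => //; first by apply: measurable_fun_ltr.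
have a_gt0 w : 0 < a w by rewrite /a; case: ifPn.
have ga : {ae P, forall w, g w = a w}.
  by apply: filterS g_gt0 => w gw; rewrite /a gw.
have a4 := expected_utility_quarter hU g_a ma ga.
have foc (f : L0 P) (Cf : C f) := first_order_condition hU hy ma (mmax f)
  (fun w => ltW (a_gt0 w)) (max_ge0 f) a4
  (expected_utility_optimal hU convC Cg g_sup Cf ma (mmax f) ga
    (L0_nneg_max0 (C_ge0 _ Cf))) a_gt0.
pose u w := derive1 (U w) (a w).
have mu : measurable_fun [set: T] u by exact: measurable_marginal_utility.
have u_gt0 w : 0 < u w by exact: marginal_utility_gt0.
have mua : measurable_fun [set: T] (fun w => u w * a w).
  exact: measurable_funM.
(* The normalizing constant of the density, positive since [u a > 0] and finite by the first-order
   condition. *)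
pose c := fine (\int[P]_w (u w * a w)%:E).
have I_gt0 : (0 < \int[P]_w (u w * a w)%:E)%E.
  apply: integral_gt0_ae; first exact/measurable_EFinP.
  by move=> w; rewrite lte_fin mulr_gt0.
have cE : (\int[P]_w (u w * a w)%:E)%E = c%:E.
  by rewrite fineK// ge0_fin_numE ?ltW//; have [] := foc g Cg.
have c_gt0 : 0 < c by rewrite -lte_fin -cE.
have [|||Q [PQ QP QE]] :=
    @exists_density_probability _ _ _ P (fun w => c^-1 * (u w * a w)).
- exact: measurable_funM.
- by move=> w; rewrite !mulr_gt0// invr_gt0.
- under eq_integral do rewrite EFinM.
  rewrite ge0_integralZl//; last 3 first.
  + exact/measurable_EFinP.
  + by move=> w _; rewrite lee_fin mulr_ge0// ltW.
  + by rewrite lee_fin invr_ge0 ltW.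
  by rewrite cE -EFinM mulVf// gt_eqF.
exists Q; split=> // f Cf.
have mba : measurable_fun [set: T] (fun w => Num.max (f w) 0 / a w).
  apply: measurable_funM => //.
  exact: (measurableT_comp (@measurable_invr R)).
(* The change of representatives concerns a [P]-null set, which is also [Q]-null. *)
have -> : (\int[Q]_w (f w / g w)%:E =
    \int[Q]_w (Num.max (f w) 0 / a w)%:E)%E.
  apply: ae_eq_integral => //.
  - apply/measurable_EFinP; apply: measurable_funM; first exact: L0_measurable.
    exact: (measurableT_comp (@measurable_invr R)).
  - exact/measurable_EFinP.
  apply: (null_dominates_ae_eq measurableT QP).
  apply: filterS (filterI ga (L0_nneg_max0 (C_ge0 _ Cf))) => w [-> {1}->] _.
  by [].
rewrite QE; [|exact/measurable_EFinP|]; last first.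
  by move=> w; rewrite lee_fin divr_ge0// ltW.
have [fb _] := foc f Cf.
(* The factor [a] of the density cancels the denominator; the first-order condition then bounds the
   integral by [c^-1 * c = 1]. *)
rewrite (_ : \int[P]_w _ =
    \int[P]_w (c^-1%:E * (u w * Num.max (f w) 0)%:E))%E.
  rewrite ge0_integralZl//; last 3 first.
  + by apply/measurable_EFinP; exact: measurable_funM.
  + by move=> w _; rewrite lee_fin mulr_ge0// ltW.
  + by rewrite lee_fin invr_ge0 ltW.
  apply: (@le_trans _ _ (c^-1%:E * c%:E)%E).
    by rewrite lee_pmul2l// ?lte_fin ?invr_gt0// -cE.
  by rewrite -EFinM mulVf// gt_eqF.
apply: eq_integral => w _; rewrite -!EFinM; congr EFin.
by have := a_gt0 w; move=> aw; field; rewrite !gt_eqF.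
Qed.
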